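(* Let $k\geq 3$ be an odd integer, let $G\cong D_{2k}\times C_2\times C_2$, where $D_{2k}$ is the dihedral group of order $2k$ and $C_2$ is the cyclic group of order $2$, and let $n=|G|$. Then there exists a strictly Deza Cayley graph $\Gamma$ over $G$ such that $\operatorname{rk}_{WL}(\Gamma)=n$.
   Context: For a finite group $G$ and an identity-free subset $S\subseteq G$, the Cayley digraph $\mathrm{Cay}(G,S)$ has vertex set $G$ and arc set $\{(g,sg): s\in S, g\in G\}$; it is a Cayley graph if $S=S^{-1}$. A $k$-regular graph on $n$ vertices is a Deza graph if there are nonnegative integers $\alpha,\beta$ such that every pair of distinct vertices has either $\alpha$ or $\beta$ common neighbours. A Deza graph is strictly Deza if it is not strongly regular and has diameter $2$. A coherent configuration on a finite set $V$ is a partition of $V\times V$ into classes satisfying the usual axioms (the diagonal is a union of classes, the partition is closed under transposition, and the number of $z$ with $(x,z)\in R$, $(z,y)\in T$ depends only on the class of $(x,y)$ for classes $R,T$); its rank is the number of classes. The WL-rank $\operatorname{rk}_{WL}(\Gamma)$ of a digraph $\Gamma=(V,E)$ is the rank of the smallest coherent configuration on $V$ for which $E$ is a union of classes. *)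

(* Defs.v *)
From mathcomp Require Import all_boot all_fingroup all_solvable.

Set Implicit Arguments.
Unset Strict Implicit.
Unset Printing Implicit Defensive.

Local Open Scope group_scope.

(* A digraph on a finite vertex set V is its arc relation [e : rel V]. *)

Definition cayley (gT : finGroupType) (S : {set gT}) : rel gT :=
  fun g h => [exists s in S, h == s * g].

Section Graphs.

Variables (V : finType) (e : rel V).

Definition simple_graph : Prop := symmetric e /\ irreflexive e.

Definition regular (k : nat) : Prop :=
  forall x : V, #|[set y | e x y]| = k.

Definition common_neighbours (x y : V) : {set V} := [set z | e x z && e y z].

Definition deza_graph : Prop :=
  simple_graph /\
  exists k a b : nat, regular k /\
    forall x y : V, x != y ->
      #|common_neighbours x y| = a \/ #|common_neighbours x y| = b.

(* Complete and edgeless graphs are not excluded; neither has diameter 2. *)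
Definition strongly_regular : Prop :=
  simple_graph /\
  exists k l m : nat, regular k /\
    forall x y : V, x != y ->
      #|common_neighbours x y| = if e x y then l else m.

Definition walk (x y : V) (d : nat) : Prop :=
  exists p : seq V, [/\ path e x p, last x p = y & size p = d].

Definition distance (x y : V) (d : nat) : Prop :=
  walk x y d /\ forall d' : nat, walk x y d' -> d <= d'.

Definition diameter (d : nat) : Prop :=
  (forall x y : V, exists2 d' : nat, distance x y d' & d' <= d) /\
  (exists x y : V, distance x y d).

Definition strictly_deza : Prop :=
  [/\ deza_graph, ~ strongly_regular & diameter 2].

End Graphs.

Section CoherentConfigurations.

Variable V : finType.

Implicit Types (P Q : {set {set V * V}}) (R T U E : {set V * V}).

Definition union_of_classes P E : bool :=
  [exists Q : {set {set V * V}}, (Q \subset P) && (cover Q == E)].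

Definition diagonal : {set V * V} := [set u | u.1 == u.2].

Definition transpose R : {set V * V} := [set u | (u.2, u.1) \in R].

Definition intersection_number R T (u : V * V) : nat :=
  #|[set z | ((u.1, z) \in R) && ((z, u.2) \in T)]|.

Definition coherent P : bool :=
  [&& partition P [set: V * V],
      union_of_classes P diagonal,
      [forall R in P, transpose R \in P]
    & [forall R in P, forall T in P, forall U in P,
        forall u in U, forall v in U,
          intersection_number R T u == intersection_number R T v]].

(* P is at most Q when every class of P is a union of classes of Q, i.e. when
   P is the coarser partition. *)
Definition config_le P Q : bool := [forall R in P, union_of_classes Q R].

Definition arcs (e : rel V) : {set V * V} := [set u | e u.1 u.2].

Definition wl_closure (e : rel V) P : bool :=
  [&& coherent P, union_of_classes P (arcs e)
    & [forall Q : {set {set V * V}},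
        coherent Q && union_of_classes Q (arcs e) ==> config_le P Q]].

(* A smallest configuration always exists and is unique, so 0 is only a junk
   value that totalizes the definition. *)
Definition wl_rank (e : rel V) : nat :=
  if [pick P | wl_closure e P] is Some P then #|P| else 0.

End CoherentConfigurations.

(* Main.v *)
(* Write G = D x C_2 x C_2 with D generated by involutions r, t whose product
   has odd order k, and let z generate C_2. The connection set is
     S = (D (z, 1) minus (r, z, 1)) + (t, 1, 1) + (t, 1, z) + (r, z, z).
   For g <> 1, |S meet g^-1 S| is |D| - 2 if g lies in D and 2 otherwise, which
   gives all the Deza properties. For the rank, the configuration generated by S
   is translation invariant, so it suffices that every singleton is obtained
   from S by intersections, complements, inverses, translations by known
   singletons and level sets of g |-> |S meet g^-1 S|. These give successively:
   (t, 1, 1), the only point of S in D; then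
   Y = S \ (t, 1, 1) S \ (t, 1, 1) = {(t, 1, z), (r, z, z), (t r, z, 1)};
   (t r, z, 1) = Y \ Y^-1, whose k-th power is (1, z, 1) as k is odd;
   (r, z, 1) = (t, 1, 1) (t r, z, 1); and (1, 1, z), the only self-inverse point
   of (r, z, 1) (Y meet Y^-1). *)
Require Import Defs.
From mathcomp Require Import all_boot all_fingroup all_solvable zmodp.

Set Implicit Arguments.
Unset Strict Implicit.
Unset Printing Implicit Defensive.

Local Open Scope group_scope.

(** * Coherent configurations: closure properties and uniqueness of the smallest one *)

Section CoherentClosure.

Variable V : finType.
Implicit Types (P Q : {set {set V * V}}) (R T E : {set V * V}).

(** Replaces the choice of a subfamily by invariance along blocks, which makes Boolean closure
    immediate. *)
Lemma union_of_classesP P E : partition P [set: V * V] ->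
  reflect (forall u v, pblock P u = pblock P v -> (u \in E) = (v \in E))
          (union_of_classes P E).
Proof.
move=> partP; have [/eqP covP trivP _] := and3P partP.
have inP u : u \in cover P by rewrite covP inE.
apply: (iffP existsP) => [[Q /andP[/subsetP sQP /eqP <-]] u v eq_uv | invE].
  suff: forall u v, pblock P u = pblock P v -> u \in cover Q -> v \in cover Q.
    by move=> sub; apply/idP/idP; apply: sub.
  move=> {eq_uv}u {}v eq_uv /bigcupP[R QR uR]; apply/bigcupP; exists R => //.
  by rewrite -(def_pblock trivP (sQP _ QR) uR) eq_uv mem_pblock.
exists [set R in P | R \subset E]; apply/andP; split.
  by apply/subsetP=> R; rewrite inE => /andP[].
apply/eqP/setP=> u; apply/bigcupP/idP => [[R] | uE].
  by rewrite inE => /andP[_ /subsetP sRE] /sRE.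
exists (pblock P u); last by rewrite mem_pblock.
rewrite inE pblock_mem //; apply/subsetP=> v vu.
by rewrite -(invE u v) // (same_pblock trivP vu).
Qed.

(** Classes are nonempty, so each class of one partition contains some point [u]. Invariance in both
    directions then forces it to be the block of [u] in the other partition. *)
Lemma config_le_antisym P Q : partition P [set: V * V] ->
  partition Q [set: V * V] -> config_le P Q -> config_le Q P -> P = Q.
Proof.
have sub P1 P2 : partition P1 [set: V * V] -> partition P2 [set: V * V] ->
    config_le P1 P2 -> config_le P2 P1 -> P1 \subset P2.
  move=> part1 part2 /forall_inP le12 /forall_inP le21.
  have [_ triv1 n01] := and3P part1; have [/eqP cov2 triv2 _] := and3P part2.
  apply/subsetP=> R PR.
  have [u uR] : exists u, u \in R.
    by apply/set0Pn; apply: contraNneq n01 => <-.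
  have u2 : u \in cover P2 by rewrite cov2 inE.
  suff -> : R = pblock P2 u by apply: pblock_mem.
  have inv1 := union_of_classesP _ part2 (le12 R PR).
  have inv2 := union_of_classesP _ part1 (le21 _ (pblock_mem u2)).
  apply/eqP; rewrite eqEsubset; apply/andP; split; apply/subsetP=> v.
    move=> vR; rewrite -(inv2 u v) ?mem_pblock //.
    by rewrite !(def_pblock triv1 PR).
  by move=> vu; rewrite -(inv1 u v) // (same_pblock triv2 vu).
by move=> partP partQ leP leQ; apply/eqP; rewrite eqEsubset !sub.
Qed.

Lemma wl_rank_unique (e : rel V) P : wl_closure e P -> wl_rank e = #|P|.
Proof.
move=> wlP; rewrite /wl_rank.
case: pickP => [Q wlQ | /(_ P)]; last by rewrite wlP.
have [cohP uP /forallP minP] := and3P wlP.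
have [cohQ uQ /forallP minQ] := and3P wlQ.
congr #|pred_of_set _|; apply: config_le_antisym.
- by case/and4P: cohQ.
- by case/and4P: cohP.
- by apply: (implyP (minQ P)); rewrite cohP.
- by apply: (implyP (minP Q)); rewrite cohQ.
Qed.

Variable P : {set {set V * V}}.
Hypothesis cohP : coherent P.

Let partP : partition P [set: V * V]. Proof. by case/and4P: cohP. Qed.
Let trivP : trivIset P. Proof. by case/and3P: partP. Qed.
Let inP u : u \in cover P. Proof. by rewrite (cover_partition partP) inE. Qed.

Lemma union_of_classesI R T :
  union_of_classes P R -> union_of_classes P T -> union_of_classes P (R :&: T).
Proof.
move=> /(union_of_classesP _ partP) uR /(union_of_classesP _ partP) uT.
by apply/(union_of_classesP _ partP) => u v uv; rewrite !inE (uR u v) ?(uT u v).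
Qed.

Lemma union_of_classesC R : union_of_classes P R -> union_of_classes P (~: R).
Proof.
move=> /(union_of_classesP _ partP) uR.
by apply/(union_of_classesP _ partP) => u v uv; rewrite !inE (uR u v).
Qed.

Lemma union_of_classes_transpose R :
  union_of_classes P R -> union_of_classes P (transpose R).
Proof.
move=> /(union_of_classesP _ partP) uR.
have /forall_inP trP : [forall R in P, transpose R \in P] by case/and4P: cohP.
apply/(union_of_classesP _ partP) => u v uv; rewrite !inE; apply: uR.
have PTu : transpose (pblock P u) \in P by apply/trP/pblock_mem.
have def w : w \in pblock P u -> pblock P (w.2, w.1) = transpose (pblock P u).
  by move=> wu; apply: (def_pblock trivP PTu); rewrite inE -surjective_pairing.
by rewrite def ?mem_pblock // def // uv mem_pblock.
Qed.

(** The middle vertices are sorted by the pair of classes of their two arcs. Each pair contributes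
    either nothing or an intersection number of two classes, which is constant on blocks by
    coherence. *)
Lemma union_of_classes_intersection_number R T m :
    union_of_classes P R -> union_of_classes P T ->
  union_of_classes P [set u | intersection_number R T u == m].
Proof.
move=> /(union_of_classesP _ partP) uR /(union_of_classesP _ partP) uT.
have /forall_inP intP : [forall R in P, forall T in P, forall U in P,
    forall u in U, forall v in U,
      intersection_number R T u == intersection_number R T v].
  by case/and4P: cohP.
apply/(union_of_classesP _ partP) => u v uv; rewrite !inE; congr (_ == m).
pose cls (w : V * V) z := (pblock P (w.1, z), pblock P (z, w.2)).
have split w : intersection_number R T w =
    (\sum_(C : {set V * V} * {set V * V}) #|[set z |
       ((w.1, z) \in R) && ((z, w.2) \in T) && (cls w z == C)]|)%N.
  rewrite /intersection_number -sum1_card (partition_big (cls w) xpredT) //=.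
  apply: eq_bigr => C _; rewrite -sum1_card.
  by apply: eq_bigl => z; rewrite !inE.
rewrite !split; apply: eq_bigr => -[C D] _.
have [PC|nPC] := boolP (C \in P); last first.
  rewrite !eq_card0 // => z; rewrite !inE /cls xpair_eqE;
  by apply: contraNF nPC => /andP[_ /andP[/eqP<- _]]; apply: pblock_mem.
have [PD|nPD] := boolP (D \in P); last first.
  rewrite !eq_card0 // => z; rewrite !inE /cls xpair_eqE;
  by apply: contraNF nPD => /andP[_ /andP[_ /eqP<-]]; apply: pblock_mem.
have inblock x B : B \in P -> (pblock P x == B) = (x \in B).
  move=> PB; apply/eqP/idP => [<-|/(def_pblock trivP PB)//].
  by rewrite mem_pblock.
(* A class is either contained in a union of classes or disjoint from it, so the conditions on [R]
   and [T] depend only on [C] and [D]. *)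
have red w : #|[set z | ((w.1, z) \in R) && ((z, w.2) \in T)
       && (cls w z == (C, D))]| =
    (if (C \subset R) && (D \subset T) then intersection_number C D w else 0)%N.
  have sub (x : V * V) B E :
      (forall y z, pblock P y = pblock P z -> (y \in E) = (z \in E)) ->
      B \in P -> x \in B -> (x \in E) = (B \subset E).
    move=> invE PB xB; apply/idP/subsetP => [xE y yB|->//].
    by rewrite -(invE x y) // !(def_pblock trivP PB).
  case: ifP => sCD; last first.
    apply: eq_card0 => z; rewrite !inE /cls xpair_eqE !inblock //.
    apply: contraFF sCD => /andP[/andP[zR zT] /andP[zC zD]].
    by rewrite -(sub _ _ _ uR PC zC) -(sub _ _ _ uT PD zD) zR.
  have [/subsetP sCR /subsetP sDT] := andP sCD.
  apply: eq_card => z; rewrite !inE /cls xpair_eqE !inblock //.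
  by apply: andb_idl => /andP[/sCR-> /sDT].
rewrite !red; case: ifP => // _; apply/eqP.
have /forall_inP := intP C PC; move/(_ D PD)/forall_inP.
move/(_ (pblock P u) (pblock_mem (inP u)))/forall_inP/(_ u).
rewrite mem_pblock => /(_ (inP u))/forall_inP/(_ v).
by rewrite uv mem_pblock; apply.
Qed.

End CoherentClosure.

(** * Translation-invariant configurations on a group and the WL-rank of Cayley digraphs *)

Section CayleyDigraphs.

Variable gT : finGroupType.
Implicit Types (S X Y : {set gT}) (x y g h : gT).

Lemma cayleyE S g h : cayley S g h = (h * g^-1 \in S).
Proof.
apply/exists_inP/idP => [[s sS /eqP->]|]; first by rewrite mulgK.
by move=> hS; exists (h * g^-1); rewrite ?mulgKV.
Qed.

Lemma mem_arcs_cayley S u : (u \in arcs (cayley S)) = (u.2 * u.1^-1 \in S).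
Proof. by rewrite inE cayleyE. Qed.

(** For symmetric [S] this is the coefficient of [g] in the square of the sum of [S] in the group
    ring. *)
Definition meet_card S g := #|[set u in S | g * u \in S]|.

(* The connection sets of the relations of a translation-invariant coherent
   configuration form the S-sets of a Schur ring; only the closure properties
   needed to separate points are recorded. *)
Definition schur_closed (F : pred {set gT}) : Prop :=
  [/\ forall X Y, F X -> F Y -> F (X :&: Y),
      forall X, F X -> F (~: X),
      forall X, F X -> F X^-1,
      forall x X, F [set x] -> F X -> F (x *: X)
    & forall X m, X^-1 = X -> F X -> F [set g | meet_card X g == m]].

(** Quantifying over closed families expresses that [S] separates all points without constructing
    the Schur ring that it generates. *)
Definition schur_generates S : Prop :=
  forall F, schur_closed F -> F S -> forall g, F [set g].

Lemma coherent_schur_closed (P : {set {set gT * gT}}) : coherent P ->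
  schur_closed (fun X => union_of_classes P (arcs (cayley X))).
Proof.
move=> cohP; split=> [X Y FX FY|X FX|X FX|x X Fx FX|X m symX FX].
- suff -> : arcs (cayley (X :&: Y)) = arcs (cayley X) :&: arcs (cayley Y).
    exact: union_of_classesI.
  by apply/setP=> u; rewrite in_setI !mem_arcs_cayley inE.
- suff -> : arcs (cayley (~: X)) = ~: arcs (cayley X).
    exact: union_of_classesC.
  by apply/setP=> u; rewrite in_setC !mem_arcs_cayley inE.
- suff -> : arcs (cayley X^-1) = transpose (arcs (cayley X)).
    exact: union_of_classes_transpose.
  apply/setP=> u; rewrite [RHS]inE !mem_arcs_cayley mem_invg /=.
  by rewrite invMg invgK.
(* The only possible middle vertex is [x^-1 * u.2], so the intersection number is 0 or 1, and it is
   1 exactly on the arcs of the translate. *)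
- suff -> : arcs (cayley (x *: X)) =
      [set u | intersection_number (arcs (cayley X)) (arcs (cayley [set x])) u
                 == 1%N].
    exact: union_of_classes_intersection_number.
  apply/setP=> u; rewrite [RHS]inE mem_arcs_cayley mem_lcoset.
  rewrite /intersection_number.
  rewrite (_ : [set z | _] = if x^-1 * (u.2 * u.1^-1) \in X
                             then [set x^-1 * u.2] else set0).
    by case: ifP => _; rewrite ?cards1 ?cards0.
  apply/setP=> z; rewrite !inE !cayleyE inE /=.
  have -> : (u.2 * z^-1 == x) = (z == x^-1 * u.2).
    by apply/eqP/eqP => [<-|->]; rewrite invMg invgK ?mulgKV ?mulKVg.
  have [->|ne] := eqVneq z (x^-1 * u.2); last first.
    by case: ifP; rewrite andbF !inE // (negPf ne).
  by rewrite andbT mulgA; case: ifP; rewrite !inE ?eqxx.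
suff -> : arcs (cayley [set g | meet_card X g == m]) =
    [set u | intersection_number (arcs (cayley X)) (arcs (cayley X)) u == m].
  exact: union_of_classes_intersection_number.
apply/setP=> u; rewrite [RHS]inE mem_arcs_cayley inE; congr (_ == m).
rewrite /intersection_number /meet_card.
(* The map sending [y] to [y^-1 * u.1] matches the elements counted by [meet_card] with the middle
   vertices. Symmetry of [X] is used here. *)
rewrite -(card_imset _ (inj_comp (mulIg u.1) (@invg_inj gT))) /=.
apply: eq_card => z; rewrite [RHS]inE !inE !cayleyE /=.
apply/imsetP/andP => [[y]|[zX uX]].
  rewrite inE -{1}symX mem_invg => /andP[yX uyX] ->.
  by rewrite mulgK yX invMg invgK mulgA.
exists (z * u.1^-1)^-1; last by rewrite /= invgK mulgKV.
by rewrite !inE -mem_invg symX zX invMg invgK -mulgA mulKg.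
Qed.

(** The orbitals of the right regular action of the group. *)
Definition thin_scheme : {set {set gT * gT}} :=
  [set arcs (cayley [set g]) | g : gT].

Lemma mem_thin_class g u : (u \in arcs (cayley [set g])) = (u.2 * u.1^-1 == g).
Proof. by rewrite mem_arcs_cayley inE. Qed.

Lemma thin_scheme_partition : partition thin_scheme [set: gT * gT].
Proof.
apply/and3P; split.
- apply/eqP/setP=> u; rewrite inE; apply/bigcupP.
  exists (arcs (cayley [set u.2 * u.1^-1])); first exact: imset_f.
  by rewrite mem_thin_class.
- apply/trivIsetP=> _ _ /imsetP[g _ ->] /imsetP[h _ ->] ne_gh.
  rewrite -setI_eq0; apply: contraNT ne_gh => /set0Pn[u].
  by rewrite in_setI !mem_thin_class => /andP[/eqP <- /eqP <-].
apply/imsetP=> -[g _ /setP/(_ (1, g))].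
by rewrite mem_thin_class inE invg1 mulg1 eqxx.
Qed.

Lemma pblock_thin_scheme u v : pblock thin_scheme u = pblock thin_scheme v ->
  u.2 * u.1^-1 = v.2 * v.1^-1.
Proof.
have [_ trivP _] := and3P thin_scheme_partition.
have def w : pblock thin_scheme w = arcs (cayley [set w.2 * w.1^-1]).
  by apply: (def_pblock trivP); [apply: imset_f | rewrite mem_thin_class].
by rewrite !def => /setP/(_ u); rewrite !mem_thin_class eqxx => /esym/eqP.
Qed.

Lemma thin_scheme_union S : union_of_classes thin_scheme (arcs (cayley S)).
Proof.
apply/(union_of_classesP _ thin_scheme_partition) => u v /pblock_thin_scheme uv.
by rewrite !mem_arcs_cayley uv.
Qed.

Lemma thin_scheme_coherent : coherent thin_scheme.
Proof.
apply/and4P; split; first exact: thin_scheme_partition.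
- suff -> : diagonal gT = arcs (cayley [set 1]) by apply: thin_scheme_union.
  by apply/setP=> u; rewrite mem_thin_class inE -eq_mulgV1 eq_sym.
- apply/forall_inP=> _ /imsetP[g _ ->]; apply/imsetP; exists g^-1 => //.
  apply/setP=> u; rewrite mem_thin_class inE mem_thin_class /=.
  by rewrite -eq_invg_sym invMg invgK.
apply/forall_inP=> _ /imsetP[g _ ->]; apply/forall_inP=> _ /imsetP[h _ ->].
apply/forall_inP=> _ /imsetP[x _ ->]; apply/forall_inP=> u ux.
apply/forall_inP=> v vx; move: ux vx; rewrite !mem_thin_class.
have count w :
    intersection_number (arcs (cayley [set g])) (arcs (cayley [set h])) w =
    (w.2 * w.1^-1 == h * g).
  rewrite /intersection_number; set A := [set z | _].
  (* The first arc forces the middle vertex to be [g * w.1]; the second arc then fixes the quotient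
     of [w]. *)
  have -> : A = if w.2 * w.1^-1 == h * g then [set g * w.1] else set0.
    apply/setP=> z; rewrite !inE !cayleyE !inE /=.
    rewrite (can2_eq (mulgKV _) (mulgK _)).
    have [->|ne] := eqVneq z (g * w.1); last first.
      by case: ifP; rewrite !inE // (negPf ne).
    rewrite invMg mulgA (can2_eq (mulgKV _) (mulgK _)).
    by case: ifP => _; rewrite !inE ?eqxx.
  by case: ifP; rewrite ?cards1 ?cards0.
by move=> /eqP ux /eqP vx; rewrite !count ux vx.
Qed.

(** The thin scheme always contains the arcs as a union of classes. Generation makes each of its
    classes a union of classes in any competing configuration, so it is the smallest one. *)
Lemma wl_rank_generates S :
  schur_generates S -> wl_rank (cayley S) = #|[set: gT]|.
Proof.
move=> genS; rewrite (@wl_rank_unique _ _ thin_scheme).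
  rewrite cardsT card_imset // => g h /setP/(_ (1, g)).
  by rewrite !mem_thin_class invg1 mulg1 eqxx => /esym/eqP.
apply/and3P; split; [exact: thin_scheme_coherent | exact: thin_scheme_union |].
apply/forallP=> Q; apply/implyP=> /andP[cohQ SQ].
apply/forall_inP=> _ /imsetP[g _ ->].
exact: (genS _ (coherent_schur_closed cohQ)).
Qed.

(** * A criterion for a Cayley graph to be strictly Deza *)

Section Deza.

Variable S : {set gT}.
Hypotheses (S1 : 1 \notin S) (symS : S^-1 = S).

Lemma card_common_neighbours g h :
  #|common_neighbours (cayley S) g h| = meet_card S (h * g^-1).
Proof.
rewrite /meet_card -[RHS](card_imset _ (inj_comp (mulIg g) (@invg_inj gT))) /=.
apply: eq_card => z; rewrite [LHS]inE !cayleyE.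
apply/andP/imsetP => [[zg zh]|[y]].
  exists (z * g^-1)^-1; last by rewrite /= invgK mulgKV.
  by rewrite inE -mem_invg symS zg -symS mem_invg !invMg !invgK -!mulgA mulKg.
rewrite inE -{1}symS mem_invg => /andP[yS hyS] ->; rewrite mulgK yS; split=> //.
by rewrite -symS mem_invg !invMg !invgK mulgA.
Qed.

(** Positive counts join any two vertices by a walk of length 2, and [x] is at distance exactly 2
    from [1]. The neighbours [s] and [t] of [1] share different numbers of neighbours with it, which
    refutes strong regularity. *)
Lemma strictly_deza_cayley a b s t x :
    (forall g, g != 1 -> 0 < meet_card S g /\ meet_card S g \in [:: a; b]) ->
    s \in S -> t \in S -> meet_card S s != meet_card S t ->
    x != 1 -> x \notin S ->
  strictly_deza (cayley S).
Proof.
move=> meetS sS tS ne_st x1 xS.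
have simpleS : simple_graph (cayley S).
  split=> [g h|g]; last by rewrite cayleyE mulgV (negPf S1).
  by rewrite !cayleyE -{1}symS mem_invg invMg invgK.
have regS : regular (cayley S) #|S|.
  move=> g; rewrite -(card_imset S (mulIg g)); apply: eq_card => h.
  rewrite inE cayleyE.
  apply/idP/imsetP => [hS|[y yS ->]]; last by rewrite mulgK.
  by exists (h * g^-1); rewrite ?mulgKV.
have ne1 g h : g != h -> h * g^-1 != 1 by rewrite -eq_mulgV1 eq_sym.
split.
- split=> //; exists #|S|, a, b; split=> // g h /ne1/meetS[_].
  by rewrite card_common_neighbours !inE => /orP[]/eqP; [left|right].
- case=> _ [d [l [m [_ srgS]]]]; case/eqP: ne_st.
  have meet u : u \in S -> meet_card S u = l.
    move=> uS; have ne : 1 != u by apply: contraNneq S1 => ->.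
    have := srgS _ _ ne.
    by rewrite card_common_neighbours cayleyE invg1 mulg1 uS.
  by rewrite !meet.
have walk0 g h : walk (cayley S) g h 0 -> g = h by case=> -[|y p] [].
have walk1 g h : walk (cayley S) g h 1 -> cayley S g h.
  by case=> -[|y [|z p]] [] //=; rewrite andbT => ? <-.
have walk2 g h : g != h -> walk (cayley S) g h 2.
  move=> /ne1/meetS[+ _]; rewrite -card_common_neighbours => /card_gt0P[z].
  rewrite inE => /andP[gz hz]; exists [:: z; h]; split=> //=.
  by rewrite gz simpleS.1 hz.
have dist2 g h : g != h -> ~~ cayley S g h -> distance (cayley S) g h 2.
  move=> ne nS; split=> [|[|[|d]] //]; first exact: walk2.
    by move/walk0 => eq_gh; rewrite eq_gh eqxx in ne.
  by move/walk1 => gh; rewrite gh in nS.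
split=> [g h|]; last first.
  by exists 1, x; apply: dist2; rewrite 1?eq_sym // cayleyE invg1 mulg1.
have [->|ne] := eqVneq g h; first by exists 0; split=> //; exists [::].
have [gh|ngh] := boolP (cayley S g h); last by exists 2; [apply: dist2 |].
exists 1%N => //; split=> [|[|d] //]; first by exists [:: h]; rewrite /= gh.
by move/walk0 => eq_gh; rewrite eq_gh eqxx in ne.
Qed.

End Deza.

End CayleyDigraphs.

(** * Transport along a group isomorphism *)

Section Transport.

Variables (gT hT : finGroupType) (f : {morphism [set: gT] >-> hT}).
Hypothesis bij_f : bijective f.
Variable S : {set hT}.

Let fM x y : f (x * y) = f x * f y. Proof. by rewrite morphM ?inE. Qed.
Let fV x : f x^-1 = (f x)^-1. Proof. by rewrite morphV ?inE. Qed.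

Lemma meet_card_preim g : meet_card (f @^-1: S) g = meet_card S (f g).
Proof.
rewrite /meet_card -(on_card_preimset (f := f)); last exact: onW_bij.
by apply: eq_card => u; rewrite !inE fM.
Qed.

Lemma invg_preim : (f @^-1: S)^-1 = f @^-1: S^-1.
Proof. by apply/setP=> u; rewrite !inE fV. Qed.

Lemma preim1 g : f @^-1: [set f g] = [set g].
Proof. by apply/setP=> u; rewrite !inE (bij_eq bij_f). Qed.

End Transport.

Lemma schur_generates_preim (gT hT : finGroupType)
    (f : {morphism [set: gT] >-> hT}) (S : {set hT}) :
  bijective f -> schur_generates S -> schur_generates (f @^-1: S).
Proof.
move=> bij_f genS F [FI FC FV FL FM] FS g; rewrite -(preim1 bij_f).
(* The sets whose preimages lie in [F] again form a closed family. *)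
apply: (genS (fun X => F (f @^-1: X))) => //; have [f' fK f'K] := bij_f.
split=> [X Y FX FY|X FX|X FX|x X Fx FX|X m symX FX].
- by rewrite preimsetI FI.
- by rewrite preimsetC FC.
- by rewrite -invg_preim FV.
- rewrite (_ : _ @^-1: _ = f' x *: (f @^-1: X)).
    by rewrite FL // -(preim1 bij_f) f'K.
  by apply/setP=> u; rewrite !(inE, mem_lcoset) morphM ?morphV ?inE ?f'K.
rewrite (_ : _ @^-1: _ = [set u | meet_card (f @^-1: X) u == m]).
  by rewrite FM // invg_preim symX.
by apply/setP=> u; rewrite !inE meet_card_preim.
Qed.

(** Here [1] is the neutral element, that is the residue 0, and [Zp1] is the generator. *)
Lemma Z2_cases (x : 'Z_2) : x = 1 \/ x = Zp1.
Proof. by case: x => [[|[|//]] lt_x]; [left | right]; apply: val_inj. Qed.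

Lemma Z2_mulgg (x : 'Z_2) : x * x = 1.
Proof. by case: (Z2_cases x) => ->; apply: val_inj. Qed.

(** * The connection set: common neighbour counts and separation of points *)

Section DihedralConstruction.

Variables (dT : finGroupType) (r t : dT) (k : nat).
Hypotheses (rr : r * r = 1) (tt : t * t = 1).
Hypotheses (gen_rt : <<[set r; t]>> = [set: dT]).
Hypotheses (trk : (t * r) ^+ k = 1) (odd_k : odd k) (card_dT : 4 < #|dT|).

Local Notation hT := (dT * 'Z_2 * 'Z_2)%type.
Local Notation z := (Zp1 : 'Z_2).

(* With p_1 = t and p_z = r, the set meets D * (x, y) in {(p_x, x, y)} only,
   except for D * (z, 1), which it contains but for (r, z, 1). *)
Definition deza_set : {set hT} :=
  [set h | (h.1.1 == if h.1.2 == 1 then t else r)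
             (+) ((h.1.2 != 1) && (h.2 == 1))].

Let zz : z * z = 1. Proof. exact: Z2_mulgg. Qed.
Let zV : z^-1 = z. Proof. by apply: val_inj. Qed.
Let z1 : (z == 1) = false. Proof. by []. Qed.
Let oz : (1 == z) = false. Proof. by []. Qed.
Let rV : r^-1 = r. Proof. by apply/eqP; rewrite eq_invg_mul rr. Qed.
Let tV : t^-1 = t. Proof. by apply/eqP; rewrite eq_invg_mul tt. Qed.

(** If [t] and [r] commuted, then [t * r] would have square 1 and odd power 1, so [t = r], and a
    single involution would generate a group of more than 4 elements. *)
Lemma neq_tr_rt : t * r != r * t.
Proof.
apply/eqP=> tr_rt; have tr2 : (t * r) ^+ 2 = 1.
  by rewrite expgS expg1 {1}tr_rt mulgA -(mulgA r) tt mulg1 rr.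
have eq_tr : t = r.
  apply/eqP; rewrite -rV eq_mulgV1 invgK -(expg1 (t * r)).
  move: trk; rewrite -(odd_double_half k) odd_k expgD -mul2n expgM tr2 expg1n.
  by rewrite mulg1 expg1 => ->.
have : #|dT| <= 2.
  rewrite -cardsT -gen_rt eq_tr setUid -/(<[r]>) -orderE.
  by rewrite dvdn_leq // order_dvdn expgS expg1 rr.
by move/(leq_trans card_dT).
Qed.

Let t1 : (t == 1) = false.
Proof.
by apply/negbTE; apply: contraNneq neq_tr_rt => ->; rewrite mul1g mulg1.
Qed.

Lemma mem_deza_set d x y : ((d, x, y) \in deza_set) =
  (d == if x == 1 then t else r) (+) ((x != 1) && (y == 1)).
Proof. by rewrite inE. Qed.

Lemma deza_set1 : 1 \notin deza_set.
Proof. by rewrite mem_deza_set eqxx addbF eq_sym t1. Qed.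

Lemma deza_setV : deza_set^-1 = deza_set.
Proof.
apply/setP=> -[[d x] y]; rewrite mem_invg !mem_deza_set /=.
rewrite !eq_invg1; congr (_ (+) _).
by case: ifP => _; rewrite (can2_eq invgK invgK) ?rV ?tV.
Qed.

Lemma card_prodZ2Z2 (P : pred hT) : #|[set h | P h]| =
  addn (addn #|[set d | P (d, 1, 1)]| #|[set d | P (d, 1, z)]|)
       (addn #|[set d | P (d, z, 1)]| #|[set d | P (d, z, z)]|).
Proof.
have sumZ (G : 'Z_2 -> nat) : (\sum_x G x = G 1%g + G z)%N.
  by rewrite big_ord_recl big_ord1; congr (G _ + G _)%N; apply: val_inj.
rewrite -!sum1dep_card big_mkcond /=.
transitivity (\sum_u \sum_y (if P (u, y) then 1 else 0))%N.
  by rewrite pair_bigA; apply: eq_bigr => -[].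
transitivity (\sum_d \sum_x \sum_y (if P (d, x, y) then 1 else 0))%N.
  rewrite (pair_bigA _ (fun d x => \sum_y (if P (d, x, y) then 1 else 0)))%N.
  by apply: eq_bigr => -[].
under eq_bigr => d _ do rewrite !sumZ.
by rewrite !big_split /= -!big_mkcond.
Qed.

Let fix_eq1 (g p : dT) : (g * p == p) = (g == 1).
Proof. by rewrite -[in RHS](inj_eq (mulIg p)) mul1g. Qed.

Section CoordinateCounts.

Variables g p q : dT.

(** Over each point of ['Z_2 * 'Z_2] the connection set is a point or, when the added bit is true,
    the complement of a point. This lemma and the next two cover the pairs of fibres that a
    translation can match, up to order. *)
Lemma card_pt_addb e :
  #|[set d | (d == p) (+) false & (g * d == q) (+) e]| = (g * p == q) (+) e.
Proof.
rewrite (_ : [set d | _] = if (g * p == q) (+) e then [set p] else set0).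
  by case: ifP; rewrite ?cards1 ?cards0.
apply/setP=> d; rewrite inE addbF; have [->|ne] := eqVneq d p; case: ifP.
all: by rewrite !inE ?eqxx ?(negPf ne).
Qed.

Lemma card_copt_pt :
  #|[set d | (d == p) (+) true & (g * d == q) (+) false]|
    = (g * p == q) (+) true.
Proof.
rewrite (_ : [set d | _] = if g * p == q then set0 else [set g^-1 * q]).
  by case: ifP; rewrite ?cards1 ?cards0.
apply/setP=> d; rewrite inE addbT addbF (can2_eq (mulKg _) (mulKVg _)) andbC.
have [->|ne] := eqVneq d (g^-1 * q); last first.
  by case: ifP; rewrite inE // (negPf ne).
rewrite (can2_eq (mulKVg _) (mulKg _)) eq_sym.
by case: eqP; rewrite !inE ?eqxx.
Qed.

Lemma card_copt_copt : g != 1 ->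
  #|[set d | (d == p) (+) true & (g * d == p) (+) true]| = (#|dT| - 2)%N.
Proof.
move=> g1; rewrite (_ : [set d | _] = ~: [set p; g^-1 * p]).
  by rewrite cardsCs setCK cards2 -(inj_eq (mulgI g)) mulKVg fix_eq1 g1.
by apply/setP=> d; rewrite !inE !addbT negb_or (can2_eq (mulKg _) (mulKVg _)).
Qed.

End CoordinateCounts.

(** A translation by an element of [D] preserves the four fibres: the three points contribute 0 and
    the cofinite fibre [#|dT| - 2]. Any other translation swaps fibres in pairs. *)
Lemma meet_card_deza (h : hT) : h != 1 -> meet_card deza_set h =
  if (h.1.2 == 1) && (h.2 == 1) then (#|dT| - 2)%N else 2.
Proof.
case: h => [[g x] y] h1.
have shift (d a b : _) : (g, x, y) * (d, a, b) = (g * d, x * a, y * b) by [].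
rewrite /meet_card (card_prodZ2Z2 (fun u => (u \in deza_set) && _)).
have count a b :
    #|[set d | ((d, a, b) \in deza_set)
             && ((g, x, y) * (d, a, b) \in deza_set)]|
  = #|[set d | ((d == if a == 1 then t else r) (+) ((a != 1) && (b == 1)))
             && ((g * d == if x * a == 1 then t else r)
                   (+) ((x * a != 1) && (y * b == 1)))]|.
  by apply: eq_card => d; rewrite [LHS]inE [RHS]inE shift !mem_deza_set.
rewrite !{}count.
case: (Z2_cases x) (Z2_cases y) h1 => -> [] -> h1;
  rewrite ?mulg1 ?mul1g ?zz ?eqxx ?z1 /=.
- have g1 : g != 1 by move: h1; rewrite !xpair_eqE !andbT.
  by rewrite card_copt_copt // !card_pt_addb !fix_eq1 (negPf g1) /=
             !(add0n, addn0).
(* The four counts are two indicators of equations on [g] and two negated ones. Each indicator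
   cancels against a negated one, which leaves 2. *)
all: rewrite !card_pt_addb !card_copt_pt.
- by rewrite !fix_eq1; case: eqP.
- by case: (_ == r); case: (_ == t).
by case: (_ == r); case: (_ == t).
Qed.

Lemma deza_set_schur_generates : schur_generates deza_set.
Proof.
move=> F [FI FC FV FL FM] FS.
have mul3 (d d' : dT) (x x' y y' : 'Z_2) :
  (d, x, y) * (d', x', y') = (d * d', x * x', y * y') :> hT by [].
have inv3 (d : dT) (x y : 'Z_2) :
  (d, x, y)^-1 = (d^-1, x^-1, y^-1) :> hT by [].
have FD X Y : F X -> F Y -> F (X :\: Y) by move=> FX FY; rewrite setDE FI ?FC.
have tr_rt : (t * r == r * t) = false by apply/negbTE/neq_tr_rt.
have rt_tr : (r * t == t * r) = false by rewrite eq_sym.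
have trr : (t * r == r) = false by rewrite fix_eq1.
have FT : F [set (t, 1, 1)].
  suff -> : [set (t, 1, 1)] =
      deza_set :&: [set h | meet_card deza_set h == #|dT| - 2]%N.
    by apply: FI => //; apply: FM => //; apply: deza_setV.
  (* The identity is treated apart because [meet_card_deza] excludes it; it is not in [deza_set]. *)
  apply/setP=> h; rewrite !inE; have [->|h1] := eqVneq h 1.
    have := deza_set1; rewrite inE => /negPf->.
    by rewrite !xpair_eqE /= eq_sym t1.
  rewrite meet_card_deza //; case: h {h1} => [[d x] y]; rewrite !xpair_eqE /=.
  (* The bound [4 < #|dT|] keeps the two level sets apart. *)
  have ltD : (2 == #|dT| - 2)%N = false.
    by rewrite -(subnKC card_dT) !addSn !subSS subn0.
  case: (Z2_cases x) (Z2_cases y) => -> [] ->;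
    rewrite ?eqxx ?z1 ?ltD ?andbF //=.
  by rewrite !andbT addbF.
pose Y := [set (t, 1, z); (r, z, z); (t * r, z, 1)] : {set hT}.
(* Over [(z, 1)] the set misses only [r] and its translate misses only [t * r], so the difference
   there is the point [t * r]. *)
have FY : F Y.
  suff -> : Y = deza_set :\: ((t, 1, 1) *: deza_set) :\: [set (t, 1, 1)].
    by rewrite !FD ?FL.
  apply/setP=> -[[d x] y]; rewrite !(in_setD, in_set1, mem_lcoset).
  rewrite inv3 mul3 tV invg1 !mul1g.
  rewrite !mem_deza_set !inE !xpair_eqE.
  have tdE p : (t * d == p) = (d == t * p).
    by rewrite -{1}tV (can2_eq (mulKVg _) (mulKg _)).
  case: (Z2_cases x) (Z2_cases y) => -> [] ->;
    rewrite ?eqxx ?z1 ?oz ?andbF ?andbT ?addbF ?addbT ?orbF ?tdE ?tt /=.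
  - by case: (d == t); rewrite ?andbF.
  - by have [->|] := eqVneq d t; rewrite ?t1 ?andbF.
  - by rewrite negbK; have [->|//] := eqVneq d (t * r); rewrite trr.
  by have [->|] := eqVneq d r; rewrite ?andbF // eq_sym trr.
(* The other two points of [Y] are involutions, whereas the inverse of [t * r] is [r * t], a
   different element. *)
have FP : F [set (t * r, z, 1)].
  suff -> : [set (t * r, z, 1)] = Y :\: Y^-1 by rewrite FD ?FV.
  apply/setP=> -[[d x] y]; rewrite !inE !inv3 !xpair_eqE.
  rewrite !(can2_eq (@invgK dT) (@invgK dT)) (invMg t r) rV tV.
  case: (Z2_cases x) (Z2_cases y) => -> [] ->;
    rewrite ?invg1 ?zV ?eqxx ?z1 ?oz ?andbF ?andbT ?orbF ?orFb ?andNb //.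
  by have [->|] := eqVneq d (t * r); rewrite ?andbF // tr_rt.
have FMul g h : F [set g] -> F [set h] -> F [set g * h].
  move=> Fg Fh; suff -> : [set g * h] = g *: [set h] by apply: FL.
  by apply/setP=> u; rewrite mem_lcoset !inE (can2_eq (mulKVg _) (mulKg _)).
have FR : F [set (r, z, 1)].
  suff -> : (r, z, 1) = (t, 1, 1) * (t * r, z, 1) :> hT by apply: FMul.
  by rewrite mul3 mulgA tt !mul1g.
pose Z := [set (r * t, z, z); (1, 1, z)] : {set hT}.
have FZ : F Z.
  suff -> : Z = (r, z, 1) *: (Y :&: Y^-1) by rewrite FL ?FI ?FV.
  apply/setP=> -[[d x] y]; rewrite mem_lcoset.
  rewrite [(r, z, 1)^-1]inv3 mul3 rV zV invg1 mul1g !inE !inv3 !xpair_eqE.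
  rewrite !(can2_eq (@invgK dT) (@invgK dT)) (invMg t r) rV tV.
  have rdE p : (r * d == p) = (d == r * p).
    by rewrite -{1}rV (can2_eq (mulKVg _) (mulKg _)).
  case: (Z2_cases x) (Z2_cases y) => -> [] ->;
    rewrite ?mulg1 ?zz ?invg1 ?zV ?eqxx ?z1 ?oz ?andbF ?andbT ?orbF ?orFb
            ?rdE ?rr ?andbb //.
  by have [->|//] := eqVneq d (r * (t * r)); rewrite (inj_eq (mulgI r)) tr_rt.
have FW : F [set (1, 1, z)].
  suff -> : [set (1, 1, z)] = Z :&: Z^-1 by rewrite FI ?FV.
  apply/setP=> -[[d x] y]; rewrite !inE !inv3 !xpair_eqE.
  rewrite !(can2_eq (@invgK dT) (@invgK dT)) (invMg r t) rV tV invg1.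
  case: (Z2_cases x) (Z2_cases y) => -> [] ->;
    rewrite ?invg1 ?zV ?eqxx ?z1 ?oz ?andbF ?andbT ?orbF ?orFb ?andbb //.
  by case: eqP => // ->; rewrite rt_tr.
(* The points separated so far generate the group, so it suffices that the separated points form a
   subgroup. *)
have groupK : group_set [set h | F [set h]].
  apply/group_setP; split=> [|g h]; last by rewrite !inE; apply: FMul.
  rewrite inE; suff -> : 1 = (t, 1, 1) * (t, 1, 1) :> hT by apply: FMul.
  by rewrite mul3 tt !mul1g.
pose K := Group groupK.
have inK h : (h \in K) = F [set h] by rewrite in_set.
have Kz : (1, z, 1) \in K.
  have expP n : (t * r, z, 1) ^+ n = ((t * r) ^+ n, z ^+ n, 1) :> hT.
    by elim: n => // n IHn; rewrite !expgS IHn mul3 mul1g.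
  suff -> : (1, z, 1) = (t * r, z, 1) ^+ k :> hT by rewrite groupX // inK.
  rewrite expP trk; congr (_, _, _).
  rewrite -(odd_double_half k) odd_k expgD -mul2n expgM.
  by rewrite (_ : z ^+ 2 = 1) // expg1n mulg1.
have inD d : (d \in [set d : dT | (d, 1, 1) \in K]) = ((d, 1, 1) \in K).
  exact: in_set.
have groupD : group_set [set d : dT | (d, 1, 1) \in K].
  apply/group_setP; split=> [|d d']; first by rewrite inD group1.
  rewrite !inD => Kd Kd'.
  suff -> : (d * d', 1, 1) = (d, 1, 1) * (d', 1, 1) :> hT by rewrite groupM.
  by rewrite mul3 !mul1g.
have KD d : (d, 1, 1) \in K.
  have : d \in Group groupD; last by rewrite inD.
  apply: subsetP (in_setT d); rewrite -gen_rt gen_subG subUset !sub1set.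
  rewrite !inD [X in _ && X]inK FT andbT.
  (* This product is [(r, 1, 1)], the second generator of [D]. *)
  have : (r, z, 1) * (1, z, 1) \in K by rewrite groupM // inK.
  by rewrite mul3 mulg1 zz mul1g.
case=> [[d x] y]; suff: (d, x, y) \in K by rewrite inK.
have -> : (d, x, y) = (d, 1, 1) * (1, x, 1) * (1, 1, y) :> hT.
  by rewrite !mul3 !mul1g !mulg1.
by rewrite !groupM //; [case: (Z2_cases x) => -> | case: (Z2_cases y) => ->];
  rewrite ?KD ?Kz ?inK.
Qed.

End DihedralConstruction.

(** * The dihedral group and the conclusion *)

Lemma dihedral_involutions k : 1 < k ->
  exists r t : 'D_(k.*2), [/\ r * r = 1, t * t = 1,
    <<[set r; t]>> = [set: 'D_(k.*2)] & (t * r) ^+ k = 1].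
Proof.
move=> k_gt1.
(* The Coxeter presentation by two involutions supplies the generators, with [x] as [t] and [y] as
   [r]. *)
have /existsP[[x y] /=] :
    'D_(k.*2) \homg Grp (x : y : x ^+ 2, y ^+ 2, (x * y) ^+ k).
  by rewrite -Grp'_dihedral ?homg_refl.
case/eqP=> genxy x2 y2 xyk; exists y, x.
rewrite joing_idl joing_idr in genxy.
by rewrite setUC -[<<_>>]/([set x] <*> [set y]) genxy -!(expgS _ 1) x2 y2.
Qed.

Theorem theorem1 (k : nat) (gT : finGroupType) (hk3 : 3 <= k) (hkodd : odd k)
    (hG : [set: gT] \isog setX (setX ('D_(k.*2)) [set: 'Z_2]) [set: 'Z_2]) :
  exists S : {set gT},
    [/\ 1 \notin S, S^-1 = S, strictly_deza (cayley S)
      & wl_rank (cayley S) = #|[set: gT]|].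
Proof.
have k_gt1 : 1 < k by apply: leq_trans hk3.
have [r [t [rr tt gen_rt trk]]] := dihedral_involutions k_gt1.
have card_D : 4 < #|{: gsort 'D_(k.*2)}|.
  by rewrite -cardsT card_dihedral // -(subnKC hk3) doubleD.
have /isogP[f injf imf] : [set: gT] \isog [set: gsort 'D_(k.*2) * 'Z_2 * 'Z_2].
  suff <- : setX (setX 'D_(k.*2) [set: 'Z_2]) [set: 'Z_2] = [set: _] by [].
  by apply/setP=> -[[d x] y]; rewrite !inE.
have bij_f : bijective f.
  exists (invm injf) => [g|h]; first by rewrite invmE ?inE.
  by rewrite invmK // imf inE.
set D := deza_set r t.
have DV : D^-1 = D := deza_setV rr tt.
have meetD g : g != 1 -> meet_card (f @^-1: D) g =
    if ((f g).1.2 == 1) && ((f g).2 == 1)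
    then (#|{: gsort 'D_(k.*2)}| - 2)%N else 2.
  move=> g1; rewrite meet_card_preim // meet_card_deza //.
  by rewrite morph_injm_eq1 ?inE.
have lt2 : 2 < #|{: gsort 'D_(k.*2)}| - 2 by rewrite ltn_subRL.
exists (f @^-1: D); split.
- by rewrite inE morph1 (deza_set1 rr tt gen_rt trk).
- by rewrite invg_preim DV.
- have [f' fK f'K] := bij_f.
  pose z := Zp1 : 'Z_2.
  have ne1 h : h != 1 -> f' h != 1.
    by apply: contraNneq => h1; rewrite -(f'K h) h1 morph1.
  have t1 : t != 1.
    apply: contraNneq (neq_tr_rt rr tt gen_rt trk hkodd card_D) => ->.
    by rewrite mul1g mulg1.
  (* Two neighbours of the identity are chosen, one inside [D] and one outside, to realise both
     counts. The element [(1, 1, z)] is a non-neighbour, since the fibre over [(1, z)] is the single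
     point [t]. *)
  apply: (@strictly_deza_cayley _ _ _ _ (#|{: gsort 'D_(k.*2)}| - 2) 2
           (f' (t, 1, 1)) (f' (t, 1, z)) (f' (1, 1, z))).
  + by rewrite inE morph1 (deza_set1 rr tt gen_rt trk).
  + by rewrite invg_preim DV.
  + move=> g /meetD->; case: ifP; rewrite !inE ?eqxx ?orbT; split=> //.
    by apply: leq_trans lt2.
  + by rewrite inE f'K mem_deza_set eqxx.
  + by rewrite inE f'K mem_deza_set eqxx.
  + by rewrite !meetD ?ne1 ?xpair_eqE ?(negPf t1) // !f'K /= gtn_eqF.
  + by apply: ne1; rewrite !xpair_eqE andbF.
  by rewrite inE f'K mem_deza_set /= addbF eq_sym t1.
apply: wl_rank_generates; apply: schur_generates_preim => //.
exact: (deza_set_schur_generates rr tt gen_rt trk hkodd card_D).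
Qed.
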